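(* The contravariant functors $\mathcal{F}_{\mathrm{clp}}:\mathbf{SLSpace}\to\mathbf{CLat}$ and $\mathcal{F}_{\mathrm{top}}:\mathbf{CLat}\to\mathbf{SLSpace}$ described below establish a dual equivalence of categories $\mathbf{SLSpace}\equiv^{op}\mathbf{CLat}$.
   Context: A meet-semilattice $(X,1,\curlywedge)$ is a poset in which every finite subset has a meet; $x\curlywedge y$ is the binary meet, $1$ the top (empty meet), $x\preccurlyeq y$ iff $x\curlywedge y=x$, and ${\uparrow}S=\{y: s\preccurlyeq y \text{ for some } s\in S\}$. A filter is a subset that is $\preccurlyeq$-upward closed and closed under finite meets (so it contains $1$). For filters $p,q$ put $p\sqcup q:={\uparrow}\{x\curlywedge y: x\in p,y\in q\}$. An L-morphism between semilattices $(X,1,\curlywedge)$, $(X',1',\curlywedge')$ is a semilattice homomorphism $f$ such that $f(x)=1'$ iff $x=1$, and whenever $y'\curlywedge' z'\preccurlyeq' f(x)$ there are $y,z\in X$ with $y'\preccurlyeq' f(y)$, $z'\preccurlyeq' f(z)$ and $y\curlywedge z\preccurlyeq x$. An L-space is $(X,1,\curlywedge,\tau)$ where $(X,1,\curlywedge)$ is a meet-semilattice, $(X,\tau)$ is a compact topological space, $a\sqcup b$ is a clopen filter whenever $a,b$ are clopen filters, and (HMS separation) whenever $x\not\preccurlyeq y$ there is a clopen filter $a$ with $x\in a$, $y\notin a$. Write $\mathcal F_{\mathrm{clp}}(\mathbb X)$ for the clopen filters. A selection L-space is $(X,1,\curlywedge,s,\tau)$ where $(X,1,\curlywedge,\tau)$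 is an L-space and $s$ assigns to each $x\in X$ and clopen filter $a$ a closed filter $s(x,a)$ such that for all $x,y,z$ and clopen filters $a,b$: (S1) $s(1,a)=\{1\}$; (S2) $x\preccurlyeq y$ implies $s(y,a)\subseteq s(x,a)$; (S3) if $z\in s(x\curlywedge y,a)$ there exist $u\in s(x,a)$, $v\in s(y,a)$ with $u\curlywedge v\preccurlyeq z$; (St) $a\Rightarrow b:=\{x: s(x,a)\subseteq b\}$ is a clopen filter. A selection morphism $f:(X,1,\curlywedge,s,\tau)\to(X',1',\curlywedge',s',\tau')$ is a continuous L-morphism such that for all $x\in X$ and clopen filters $a'$ of the codomain: (M1) if $y\in s(x,f^{-1}(a'))$ then $f(y)\in s'(f(x),a')$; (M2) if $y'\in s'(f(x),a')$ there is $y\in s(x,f^{-1}(a'))$ with $f(y)\preccurlyeq' y'$. $\mathbf{SLSpace}$ is the category of selection L-spaces and selection morphisms. A conditional lattice is a bounded lattice $(A,\top,\bot,\wedge,\vee)$ with a binary operation $\Rightarrow$ such that $a\Rightarrow\top=\top$ and $(a\Rightarrow b)\wedge(a\Rightarrow c)=a\Rightarrow(b\wedge c)$ for all $a,b,c$; $\mathbf{CLat}$ is the category of conditional lattices and homomorphisms preserving $\top,\bot,\wedge,\vee,\Rightarrow$. $\mathcal F_{\mathrm{clp}}$ sends a selection L-space $\mathbb X$ to the conditional lattice $(\mathcal F_{\mathrm{clp}}(\mathbb X), X,\{1\},\cap,\sqcup,\Rightarrow)$ with $\Rightarrow$ as in (St), and a selection morphism $f$ to $f^{-1}$. $\mathcal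 F_{\mathrm{top}}$ sends a conditional lattice $\mathcal A$ to $(\mathcal F(\mathcal A), A,\cap,s_{\mathcal A},\tau_{\mathcal A})$, where $\mathcal F(\mathcal A)$ is the set of lattice filters of $A$ ordered as a meet-semilattice with meet $\cap$ and top $A$, $\tau_{\mathcal A}$ is generated by the sets $\theta(a)=\{p: a\in p\}$ and their complements ($a\in A$), and $s_{\mathcal A}(p,\theta(a))$ is the set of filters $q$ containing $\{b\in A: a\Rightarrow b\in p\}$ (the clopen filters of this space are exactly the sets $\theta(a)$); it sends a homomorphism $h$ to $h^{-1}$.
   Formalization: L-spaces are additionally required to have {1} clopen; without this, {1} need not be a clopen filter (e.g. the chain ω+1 with 1 the limit point and s(x,a)={1}), so the clopen filters would have no bottom and F_clp would not land in bounded lattices. *)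

(* Defs.v *)
From HB Require Import structures.
From mathcomp Require Import all_boot all_order finmap.
From mathcomp Require Import boolp classical_sets functions filter.
(* Only these files of the topology library: its order_topology.v fixes a join
   of ordered and topological structures that starts at total orders. *)
From mathcomp Require Import topology_structure compact.

Set Implicit Arguments.
Unset Strict Implicit.
Unset Printing Implicit Defensive.

Import Order.TTheory.

Local Open Scope classical_set_scope.
Local Open Scope order_scope.

Record category := Category {
  obj :> Type;
  hom : obj -> obj -> Type;
  idm : forall X, hom X X;
  compm : forall X Y Z, hom Y Z -> hom X Y -> hom X Z;
  compm1 : forall X Y (f : hom X Y), compm f (idm X) = f;
  comp1m : forall X Y (f : hom X Y), compm (idm Y) f = f;
  compmA : forall X Y Z W (h : hom Z W) (g : hom Y Z) (f : hom X Y),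
    compm h (compm g f) = compm (compm h g) f
}.

Arguments hom {c} _ _.
Arguments idm {c} _.
Arguments compm {c X Y Z} _ _.

Record functor (C D : category) := Functor {
  fobj :> C -> D;
  fmap : forall X Y : C, hom X Y -> hom (fobj X) (fobj Y);
  fmap1 : forall X, fmap (idm X) = idm (fobj X);
  fmapM : forall X Y Z (g : hom Y Z) (f : hom X Y),
    fmap (compm g f) = compm (fmap g) (fmap f)
}.

Arguments fmap {C D} _ {X Y} _.

Record cofunctor (C D : category) := Cofunctor {
  cofobj :> C -> D;
  cofmap : forall X Y : C, hom X Y -> hom (cofobj Y) (cofobj X);
  cofmap1 : forall X, cofmap (idm X) = idm (cofobj X);
  cofmapM : forall X Y Z (g : hom Y Z) (f : hom X Y),
    cofmap (compm g f) = compm (cofmap f) (cofmap g)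
}.

Arguments cofmap {C D} _ {X Y} _.

Definition idfunctor (C : category) : functor C C :=
  @Functor C C (fun X => X) (fun X Y f => f) (fun X => erefl)
    (fun X Y Z g f => erefl).

Lemma cofunctor_comp1 (C D E : category) (G : cofunctor D E)
  (F : cofunctor C D) X : cofmap G (cofmap F (idm X)) = idm (G (F X)).
Proof. by rewrite cofmap1 cofmap1. Qed.

Lemma cofunctor_compM (C D E : category) (G : cofunctor D E)
    (F : cofunctor C D) X Y Z (g : hom Y Z) (f : hom X Y) :
  cofmap G (cofmap F (compm g f)) =
  compm (cofmap G (cofmap F g)) (cofmap G (cofmap F f)).
Proof. by rewrite cofmapM cofmapM. Qed.

Definition cofunctor_comp (C D E : category) (G : cofunctor D E)
    (F : cofunctor C D) : functor C E :=
  @Functor C E (fun X => G (F X)) (fun X Y f => cofmap G (cofmap F f))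
    (cofunctor_comp1 G F) (fun X Y Z => @cofunctor_compM C D E G F X Y Z).

Definition isom (C : category) (X Y : C) (f : hom X Y) : Prop :=
  exists g : hom Y X, compm g f = idm X /\ compm f g = idm Y.

Definition natural (C D : category) (F G : functor C D)
    (eta : forall X, hom (F X) (G X)) : Prop :=
  forall X Y (f : hom X Y),
    compm (eta Y) (fmap F f) = compm (fmap G f) (eta X).

Definition nat_isomorphic (C D : category) (F G : functor C D) : Prop :=
  exists eta : forall X, hom (F X) (G X),
    natural eta /\ forall X, isom (eta X).

Definition dual_equivalence (C D : category) (F : cofunctor C D)
    (G : cofunctor D C) : Prop :=
  nat_isomorphic (idfunctor C) (cofunctor_comp G F) /\
  nat_isomorphic (idfunctor D) (cofunctor_comp F G).

Section Filters.
Context {d : Order.disp_t} {T : tMeetSemilatticeType d}.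

Record is_filter (p : set T) : Prop := IsFilter {
  filt1 : p \top;
  filtI : forall x y, p x -> p y -> p (x `&` y);
  filtS : forall x y, x <= y -> p x -> p y
}.

Definition filter_join (p q : set T) : set T :=
  [set z | exists x y, [/\ p x, q y & x `&` y <= z]].

Lemma is_filter_top : is_filter [set \top].
Proof.
split=> [//|x y /= -> ->|x y /= + xE]; first exact: meetxx.
by rewrite xE le1x => /eqP.
Qed.

Lemma is_filterI (p q : set T) :
  is_filter p -> is_filter q -> is_filter (fun x => p x /\ q x).
Proof.
move=> [p1 pI pS] [q1 qI qS]; split=> //.
- by move=> x y [px qx] [py qy]; split; [exact: pI|exact: qI].
- by move=> x y xy [px qx]; split; [exact: pS px|exact: qS qx].
Qed.

Lemma is_filterT : is_filter [set: T]. Proof. by []. Qed.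

Lemma is_filter_join (p q : set T) :
  is_filter p -> is_filter q -> is_filter (filter_join p q).
Proof.
move=> [p1 pI pS] [q1 qI qS]; split.
- by exists \top, \top; split=> //; rewrite lex1.
- move=> x y [a [b [pa qb abx]]] [a' [b' [pa' qb' aby]]].
  exists (a `&` a'), (b `&` b'); split; [exact: pI|exact: qI|].
  by rewrite meetACA leI2.
- move=> x y xy [a [b [pa qb abx]]]; exists a, b; split=> //.
  exact: le_trans xy.
Qed.

End Filters.

#[short(type="topTMeetSemilatticeType")]
HB.structure Definition TopTMeetSemilattice (d : Order.disp_t) :=
  { T of Topological T & Order.TMeetSemilattice d T }.

Record clopenFilter (d : Order.disp_t) (X : topTMeetSemilatticeType d) :=
  ClopenFilter {
    cfset :> set X;
    cf_clopen : clopen cfset;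
    cf_filter : is_filter cfset
  }.

Lemma clopenFilter_eq d (X : topTMeetSemilatticeType d)
  (a b : clopenFilter X) : cfset a = cfset b -> a = b.
Proof.
case: a b => [a ca fa] [b cb fb] /= ab; subst b.
by congr ClopenFilter; exact: Prop_irrelevance.
Qed.

HB.mixin Record isLSpace (d : Order.disp_t) T of TopTMeetSemilattice d T := {
  lspace_compact : compact [set: T];
  (* The empty join: without it {1}, the bottom of the lattice of clopen
     filters, need not be clopen (e.g. on the chain omega + 1 with 1 the limit
     point). *)
  lspace_clopen1 : clopen [set (\top : T)];
  (* Joins of filters are always filters, see [is_filter_join]. *)
  lspace_clopenU : forall a b : clopenFilter T, clopen (filter_join a b);
  lspace_sep : forall x y : T, ~ x <= y ->
    exists a : clopenFilter T, cfset a x /\ ~ cfset a y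
}.

#[short(type="lSpaceType")]
HB.structure Definition LSpace (d : Order.disp_t) :=
  { T of isLSpace d T & TopTMeetSemilattice d T }.

Record is_lmorphism d d' (X : topTMeetSemilatticeType d)
    (X' : topTMeetSemilatticeType d') (f : X -> X') : Prop := IsLMorphism {
  lmorI : {morph f : x y / x `&` y >-> x `&` y};
  lmor1 : forall x, f x = \top <-> x = \top;
  lmorL : forall y' z' x, y' `&` z' <= f x ->
    exists y z, [/\ y' <= f y, z' <= f z & y `&` z <= x]
}.

Lemma lmor_le d d' (X : topTMeetSemilatticeType d)
    (X' : topTMeetSemilatticeType d') (f : X -> X') :
  is_lmorphism f -> {homo f : x y / x <= y}.
Proof. by move=> fL x y /meet_idPl xy; rewrite -xy (lmorI fL) leIr. Qed.

Lemma preimage_is_filter d d' (X : topTMeetSemilatticeType d)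
    (X' : topTMeetSemilatticeType d') (f : X -> X') (a : set X') :
  is_lmorphism f -> is_filter a -> is_filter (f @^-1` a).
Proof.
move=> fL [a1 aI aS]; split=> /=.
- by rewrite (lmor1 fL \top).2.
- by move=> x y ax ay; rewrite (lmorI fL); exact: aI.
- by move=> x y xy; apply: aS; exact: lmor_le.
Qed.

Lemma preimage_clopen (X X' : topologicalType) (f : X -> X') (a : set X') :
  continuous f -> clopen a -> clopen (f @^-1` a).
Proof.
by move=> fc [oa ca]; split;
  [apply: open_comp => // x _; exact: fc|apply: closed_comp => // x _; exact: fc].
Qed.

Definition preimage_cf d d' (X : topTMeetSemilatticeType d)
    (X' : topTMeetSemilatticeType d') (f : X -> X')
    (fL : is_lmorphism f) (fc : continuous f) (a : clopenFilter X') :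
    clopenFilter X :=
  ClopenFilter (preimage_clopen fc (cf_clopen a))
    (preimage_is_filter fL (cf_filter a)).

HB.mixin Record isSelection (d : Order.disp_t) T of LSpace d T := {
  sel : T -> clopenFilter T -> set T;
  sel_closed : forall x a, closed (sel x a);
  sel_filter : forall x a, is_filter (sel x a);
  sel_S1 : forall a, sel \top a = [set \top];
  sel_S2 : forall x y a, x <= y -> sel y a `<=` sel x a;
  sel_S3 : forall x y z a, sel (x `&` y) a z ->
    exists u v, [/\ sel x a u, sel y a v & u `&` v <= z];
  sel_St_clopen : forall a b : clopenFilter T,
    clopen [set x | sel x a `<=` cfset b];
  sel_St_filter : forall a b : clopenFilter T,
    is_filter [set x | sel x a `<=` cfset b]
}.

#[short(type="selLSpaceType")]
HB.structure Definition SelLSpace (d : Order.disp_t) :=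
  { T of isSelection d T & LSpace d T }.

Definition sel_imp d (X : selLSpaceType d) (a b : clopenFilter X) :
    clopenFilter X :=
  ClopenFilter (sel_St_clopen a b) (sel_St_filter a b).

Record is_selmorphism d d' (X : selLSpaceType d) (X' : selLSpaceType d')
    (f : X -> X') : Prop := IsSelMorphism {
  selmor_L : is_lmorphism f;
  selmor_cont : continuous f;
  selmor_M1 : forall x (a' : clopenFilter X') y,
    sel x (preimage_cf selmor_L selmor_cont a') y -> sel (f x) a' (f y);
  selmor_M2 : forall x (a' : clopenFilter X') y', sel (f x) a' y' ->
    exists y, sel x (preimage_cf selmor_L selmor_cont a') y /\ f y <= y'
}.

Lemma is_selmorphism_id d (X : selLSpaceType d) :
  is_selmorphism (fun x : X => x).
Proof.
have idL : is_lmorphism (fun x : X => x).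
  by split=> // y z x yzx; exists y, z.
have idc : continuous (fun x : X => x) by move=> x.
have idE a : preimage_cf idL idc a = a by exact: clopenFilter_eq.
apply: (@IsSelMorphism _ _ _ _ _ idL idc) => x a y; rewrite idE//.
by exists y.
Qed.

Lemma is_selmorphism_comp d d' d'' (X : selLSpaceType d)
    (Y : selLSpaceType d') (Z : selLSpaceType d'') (g : Y -> Z) (f : X -> Y) :
  is_selmorphism g -> is_selmorphism f -> is_selmorphism (fun x => g (f x)).
Proof.
move=> [gL gc gM1 gM2] [fL fc fM1 fM2].
have hL : is_lmorphism (fun x => g (f x)).
  split=> [x y|x|y z x].
  - by rewrite (lmorI fL) (lmorI gL).
  - by split=> [/(lmor1 gL)/(lmor1 fL)//|->]; apply/(lmor1 gL)/(lmor1 fL).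
  - move=> /(lmorL gL)[u [v [yu zv /(lmorL fL)[u' [v' [uu vv uvx]]]]]].
    exists u', v'; split=> //; first exact: le_trans yu (lmor_le gL uu).
    exact: le_trans zv (lmor_le gL vv).
have hc : continuous (fun x => g (f x)).
  by move=> x; apply: continuous_comp; [exact: fc|exact: gc].
have hE a : preimage_cf hL hc a = preimage_cf fL fc (preimage_cf gL gc a).
  exact: clopenFilter_eq.
apply: (@IsSelMorphism _ _ _ _ _ hL hc) => x a y; rewrite hE.
  by move=> /fM1/gM1.
move=> /gM2[v [+ gvy]] => /fM2[u [us fuv]]; exists u; split=> //.
exact: le_trans (lmor_le gL fuv) gvy.
Qed.

Record slspace := SLSpaceObj {
  sl_disp : Order.disp_t;
  sl_sort :> selLSpaceType sl_disp
}.

Definition slhom (X Y : slspace) := {f : X -> Y | is_selmorphism f}.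

Lemma slhom_eq (X Y : slspace) (f g : slhom X Y) :
  (forall x, sval f x = sval g x) -> f = g.
Proof.
case: f g => [f fm] [g gm] /= /funext fg; subst g.
by congr exist; exact: Prop_irrelevance.
Qed.

Definition slid (X : slspace) : slhom X X := exist _ _ (is_selmorphism_id X).

Definition slcomp (X Y Z : slspace) (g : slhom Y Z) (f : slhom X Y) :
    slhom X Z :=
  exist _ _ (is_selmorphism_comp (svalP g) (svalP f)).

Program Definition SLSpace : category :=
  @Category slspace slhom slid slcomp _ _ _.
Next Obligation. by move=> *; exact: slhom_eq. Qed.
Next Obligation. by move=> *; exact: slhom_eq. Qed.
Next Obligation. by move=> *; exact: slhom_eq. Qed.

HB.mixin Record isConditional (d : Order.disp_t) A of Order.TBLattice d A := {
  cimp : A -> A -> A;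
  cimp1 : forall a, cimp a \top = \top;
  cimpI : forall a b c, cimp a b `&` cimp a c = cimp a (b `&` c)
}.

#[short(type="condLatticeType")]
HB.structure Definition CondLattice (d : Order.disp_t) :=
  { A of isConditional d A & Order.TBLattice d A }.

Record is_clmorphism d d' (A : condLatticeType d) (B : condLatticeType d')
    (h : A -> B) : Prop := IsCLMorphism {
  clmor1 : h \top = \top;
  clmor0 : h \bot = \bot;
  clmorI : {morph h : a b / a `&` b >-> a `&` b};
  clmorU : {morph h : a b / a `|` b >-> a `|` b};
  clmorC : {morph h : a b / cimp a b >-> cimp a b}
}.

Lemma is_clmorphism_id d (A : condLatticeType d) :
  is_clmorphism (fun a : A => a).
Proof. by []. Qed.

Lemma is_clmorphism_comp d d' d'' (A : condLatticeType d)
    (B : condLatticeType d') (C : condLatticeType d'') (g : B -> C)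
    (h : A -> B) :
  is_clmorphism g -> is_clmorphism h -> is_clmorphism (fun a => g (h a)).
Proof.
move=> [g1 g0 gI gU gC] [h1 h0 hI hU hC].
split; rewrite ?h1 ?h0//.
- by move=> a b; rewrite hI gI.
- by move=> a b; rewrite hU gU.
- by move=> a b; rewrite hC gC.
Qed.

Record clat := CLatObj {
  cl_disp : Order.disp_t;
  cl_sort :> condLatticeType cl_disp
}.

Definition clhom (A B : clat) := {h : A -> B | is_clmorphism h}.

Lemma clhom_eq (A B : clat) (f g : clhom A B) :
  (forall x, sval f x = sval g x) -> f = g.
Proof.
case: f g => [f fm] [g gm] /= /funext fg; subst g.
by congr exist; exact: Prop_irrelevance.
Qed.

Definition clid (A : clat) : clhom A A := exist _ _ (is_clmorphism_id A).

Definition clcomp (A B C : clat) (g : clhom B C) (f : clhom A B) : clhom A C :=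
  exist _ _ (is_clmorphism_comp (svalP g) (svalP f)).

Program Definition CLat : category := @Category clat clhom clid clcomp _ _ _.
Next Obligation. by move=> *; exact: clhom_eq. Qed.
Next Obligation. by move=> *; exact: clhom_eq. Qed.
Next Obligation. by move=> *; exact: clhom_eq. Qed.

Section FclpObj.
Context {d : Order.disp_t} {X : lSpaceType d}.
Implicit Types a b c : clopenFilter X.

HB.instance Definition _ := gen_eqMixin (clopenFilter X).
HB.instance Definition _ := gen_choiceMixin (clopenFilter X).

Definition cf_le a b : bool := `[< cfset a `<=` cfset b >].

Lemma cf_le_refl : reflexive cf_le.
Proof. by move=> a; apply/asboolP. Qed.

Lemma cf_le_anti : antisymmetric cf_le.
Proof.
move=> a b /andP[/asboolP ab /asboolP ba]; apply: clopenFilter_eq.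
exact/seteqP.
Qed.

Lemma cf_le_trans : transitive cf_le.
Proof.
move=> b a c /asboolP ab /asboolP bc; apply/asboolP.
exact: subset_trans ab bc.
Qed.

HB.instance Definition _ :=
  Order.Le_isPOrder.Build set_display (clopenFilter X)
    cf_le_refl cf_le_anti cf_le_trans.

Definition cf_top : clopenFilter X := ClopenFilter clopenT is_filterT.

Definition cf_bot : clopenFilter X := ClopenFilter lspace_clopen1 is_filter_top.

Definition cf_meet a b : clopenFilter X :=
  ClopenFilter (clopenI (cf_clopen a) (cf_clopen b))
    (is_filterI (cf_filter a) (cf_filter b)).

Definition cf_join a b : clopenFilter X :=
  ClopenFilter (lspace_clopenU a b)
    (is_filter_join (cf_filter a) (cf_filter b)).

Lemma cf_meetP a b c : (a <= cf_meet b c) = (a <= b) && (a <= c).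
Proof.
apply/asboolP/andP => [abc|[/asboolP ab /asboolP ac] x ax].
  by split; apply/asboolP => x /abc[].
by split; [exact: ab|exact: ac].
Qed.

Lemma cf_joinP a b c : (cf_join a b <= c) = (a <= c) && (b <= c).
Proof.
apply/asboolP/andP => [abc|[/asboolP ac /asboolP bc] x].
  split; apply/asboolP => x ax; apply: abc.
    by exists x, \top; split=> //; [exact: filt1 (cf_filter b)|rewrite meetx1].
  by exists \top, x; split=> //; [exact: filt1 (cf_filter a)|rewrite meet1x].
move=> [u [v [au bv uvx]]]; apply: filtS uvx _; first exact: cf_filter.
by apply: filtI; [exact: cf_filter|exact: ac|exact: bc].
Qed.

HB.instance Definition _ :=
  Order.POrder_MeetJoin_isLattice.Build set_display (clopenFilter X)
    cf_meetP cf_joinP.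

Lemma cf_le0x a : cf_bot <= a.
Proof. by apply/asboolP => x /= ->; exact: filt1 (cf_filter a). Qed.

Lemma cf_lex1 a : a <= cf_top.
Proof. by apply/asboolP. Qed.

HB.instance Definition _ :=
  Order.hasBottom.Build set_display (clopenFilter X) cf_le0x.
HB.instance Definition _ :=
  Order.hasTop.Build set_display (clopenFilter X) cf_lex1.

End FclpObj.

Section FclpCond.
Context {d : Order.disp_t} {X : selLSpaceType d}.
Implicit Types a b c : clopenFilter X.

Lemma sel_imp1 a : sel_imp a \top = \top.
Proof. by apply: clopenFilter_eq; apply/seteqP; split. Qed.

Lemma sel_impI a b c : sel_imp a b `&` sel_imp a c = sel_imp a (b `&` c).
Proof.
apply: clopenFilter_eq; apply/seteqP; split=> [x [xb xc] y ys|x xbc].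
  by split; [exact: xb|exact: xc].
by split=> y /xbc[].
Qed.

HB.instance Definition _ :=
  isConditional.Build set_display (clopenFilter X) sel_imp1 sel_impI.

End FclpCond.

Definition Fclp_obj (X : slspace) : clat :=
  @CLatObj set_display (clopenFilter (sl_sort X)).

Definition Fclp_fun (X Y : slspace) (f : slhom X Y) :
    Fclp_obj Y -> Fclp_obj X :=
  preimage_cf (selmor_L (svalP f)) (selmor_cont (svalP f)).

Lemma Fclp_is_clmorphism (X Y : slspace) (f : slhom X Y) :
  is_clmorphism (Fclp_fun f).
Proof.
rewrite /Fclp_fun; case: (svalP f) => /= fL fc fM1 fM2.
split=> [|| a b | a b | a b]; apply: clopenFilter_eq => //.
- by apply/seteqP; split=> x /= /(lmor1 fL).
- apply/seteqP; split=> [x /=|x /=].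
    move=> [y' [z' [ay bz /(lmorL fL)[y [z [yy zz yzx]]]]]].
    exists y, z; split=> //=; first exact: (filtS (cf_filter a) yy).
    exact: (filtS (cf_filter b) zz).
  move=> [y [z [ay bz yzx]]]; exists (sval f y), (sval f z); split=> //.
  by rewrite -(lmorI fL); exact: lmor_le.
- apply/seteqP; split=> [x /= xab y /fM1/xab//|x /= xab y'].
  move=> /fM2[y [/xab /= by_ fyy]]; exact: filtS (cf_filter b) _ _ fyy by_.
Qed.

Definition Fclp_map (X Y : slspace) (f : slhom X Y) :
    clhom (Fclp_obj Y) (Fclp_obj X) :=
  exist _ _ (Fclp_is_clmorphism f).

Program Definition Fclp : cofunctor SLSpace CLat :=
  @Cofunctor SLSpace CLat Fclp_obj Fclp_map _ _.
Next Obligation.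
by move=> X; apply: clhom_eq => a; exact: clopenFilter_eq.
Qed.
Next Obligation.
by move=> X Y Z g f; apply: clhom_eq => a; exact: clopenFilter_eq.
Qed.

Record latFilter (d : Order.disp_t) (A : tbLatticeType d) := LatFilter {
  lfset :> set A;
  lf_filter : is_filter lfset
}.

Lemma latFilter_eq d (A : tbLatticeType d) (p q : latFilter A) :
  lfset p = lfset q -> p = q.
Proof.
case: p q => [p fp] [q fq] /= pq; subst q.
by congr LatFilter; exact: Prop_irrelevance.
Qed.

Definition theta d (A : tbLatticeType d) (a : A) : set (latFilter A) :=
  [set p | lfset p a].

Section FtopObj.
Context {d : Order.disp_t} {A : tbLatticeType d}.
Implicit Types (a b c : A) (p q r : latFilter A).

HB.instance Definition _ := gen_eqMixin (latFilter A).
HB.instance Definition _ := gen_choiceMixin (latFilter A).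

Definition lf_le p q : bool := `[< lfset p `<=` lfset q >].

Lemma lf_le_refl : reflexive lf_le.
Proof. by move=> a; apply/asboolP. Qed.

Lemma lf_le_anti : antisymmetric lf_le.
Proof.
move=> p q /andP[/asboolP pq /asboolP qp]; apply: latFilter_eq.
exact/seteqP.
Qed.

Lemma lf_le_trans : transitive lf_le.
Proof.
move=> q p r /asboolP pq /asboolP qr; apply/asboolP.
exact: subset_trans pq qr.
Qed.

HB.instance Definition _ :=
  Order.Le_isPOrder.Build set_display (latFilter A)
    lf_le_refl lf_le_anti lf_le_trans.

Definition lf_top : latFilter A := LatFilter is_filterT.

Definition lf_meet p q : latFilter A :=
  LatFilter (is_filterI (lf_filter p) (lf_filter q)).

Lemma lf_meetP p q r : (p <= lf_meet q r) = (p <= q) && (p <= r).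
Proof.
apply/asboolP/andP => [pqr|[/asboolP pq /asboolP pr] x px].
  by split; apply/asboolP => x /pqr[].
by split; [exact: pq|exact: pr].
Qed.

Lemma lf_lex1 p : p <= lf_top. Proof. by apply/asboolP. Qed.

HB.instance Definition _ :=
  Order.POrder_isMeetSemilattice.Build set_display (latFilter A) lf_meetP.
HB.instance Definition _ :=
  Order.hasTop.Build set_display (latFilter A) lf_lex1.

Definition theta_subbase : set (set (latFilter A)) :=
  [set U | exists a, U = theta a \/ U = (~` theta a)%classic].

HB.instance Definition _ :=
  isSubBaseTopological.Build (latFilter A) theta_subbase id.

Lemma theta_subbase_open U : theta_subbase U -> open U.
Proof.
move=> DU; exists [set U]; last by rewrite bigcup_set1.
by move=> _ ->; exact: (finI_from1 id DU).
Qed.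

Lemma theta_clopen a : clopen (theta a).
Proof.
split; first by apply: theta_subbase_open; exists a; left.
rewrite -(setCK (theta a)); apply: open_closedC.
by apply: theta_subbase_open; exists a; right.
Qed.

Lemma theta_filter a : is_filter (theta a).
Proof.
split=> [//|p q pa qa|p q /asboolP pq pa]; first by split.
exact: pq.
Qed.

Definition theta_cf a : clopenFilter (latFilter A) :=
  ClopenFilter (theta_clopen a) (theta_filter a).

Lemma latFilter_cvg (F : set_system (latFilter A)) p : Filter F ->
  (forall a, lfset p a -> F (theta a)) ->
  (forall a, ~ lfset p a -> F (~` theta a)%classic) -> F --> p.
Proof.
move=> FF Fp FNp W; rewrite /= nbhsE => -[B [[D' D'D <-] [E D'E Ep]] BW].
apply: filterS BW _; have [K KD KE] := D'D _ D'E.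
apply: (@filterS _ _ _ E); first by move=> q Eq; exists E.
rewrite -KE; apply: filter_bigI => U UK.
have /set_mem[a [UE|UE]] := KD _ UK; rewrite /= UE.
- by apply: Fp; move: Ep; rewrite -KE => /(_ _ UK); rewrite /= UE.
- by apply: FNp; move: Ep; rewrite -KE => /(_ _ UK); rewrite /= UE.
Qed.

Lemma latFilter_compact : compact [set: latFilter A].
Proof.
rewrite compact_ultra => F FU _.
have FF : is_filter [set a | F (theta a)].
  split=> /=.
  - by apply: filterS filterT => p _; exact: filt1 (lf_filter p).
  - move=> a b Fa Fb; apply: filterS (filterI Fa Fb) => p [pa pb].
    exact: filtI (lf_filter p) _ _ pa pb.
  - move=> a b ab; apply: filterS => p; exact: filtS (lf_filter p) _ _ ab.
exists (LatFilter FF); split=> //; apply: latFilter_cvg => //= a Fa.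
by have [//|] := in_ultra_setVsetC (theta a) FU.
Qed.

Lemma closed_lf_up (S : set A) :
  closed [set q : latFilter A | S `<=` lfset q].
Proof.
rewrite [X in closed X](_ : _ = (\bigcap_(a in S) theta a)%classic).
  by apply: closed_bigI => a _; exact: (theta_clopen a).2.
by apply/seteqP; split=> q Sq a /Sq.
Qed.

Lemma closed_lf_down p : closed [set q : latFilter A | lfset q `<=` lfset p].
Proof.
rewrite [X in closed X](_ : _ = (\bigcap_(a in ~` lfset p) (~` theta a))%classic).
  by apply: closed_bigI => a _; exact/open_closedC/(theta_clopen a).1.
apply/seteqP; split=> [q qp a + qa|q qp a qa]; first by apply; exact: qp.
by apply: contrapT => pa; exact: qp pa qa.
Qed.

End FtopObj.

Lemma compact_directed (T : topologicalType) (I : Type) (D : set I)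
    (F : I -> set T) : compact [set: T] -> (exists i, D i) ->
  (forall i, D i -> closed (F i)) -> (forall i, D i -> F i !=set0) ->
  (forall i j, D i -> D j -> exists2 k, D k & F k `<=` (F i `&` F j)%classic) ->
  exists x, forall i, D i -> F i x.
Proof.
move=> cT D0 Fcl FN0 Fdir.
have PF : ProperFilter (filter_from D F).
  apply: filter_from_proper => //; exact: filter_from_filter.
have [x [_ xF]] := cT _ PF filterT.
exists x => i Di; apply: Fcl => // B /xF; apply.
by exists i.
Qed.

Section ClopenFiltersOfFtop.
Context {d : Order.disp_t} {A : tbLatticeType d}.
Implicit Types (a b c : A) (p q r : latFilter A).

Lemma is_filter_up a : is_filter [set b | a <= b].
Proof.
by split=> [|x y /= ax ay|x y xy /= ax];
  rewrite /= ?lex1// ?lexI ?ax//; exact: le_trans ax xy.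
Qed.

Definition lf_up a : latFilter A := LatFilter (is_filter_up a).

Lemma theta_inj : injective (@theta d A).
Proof.
move=> a b ab; apply/le_anti/andP; split.
- have : theta b (lf_up a) by rewrite -ab /theta /=.
  by [].
- have : theta a (lf_up b) by rewrite ab /theta /=.
  by [].
Qed.

Lemma theta_surj (U : clopenFilter (latFilter A)) :
  exists a, cfset U = theta a.
Proof.
case: U => U [oU cU] [U1 UI US] /=.
have [m mU] : exists m, forall p, U p ->
    (U `&` [set q : latFilter A | lfset q `<=` lfset p])%classic m.
  apply: (compact_directed latFilter_compact).
  - by exists \top.
  - by move=> p Up; apply: closedI => //; exact: closed_lf_down.
  - by move=> p Up; exists p; split.
  - move=> p q Up Uq; exists (p `&` q); first exact: UI.
    by move=> r [Ur rpq]; split; split=> // x /rpq[].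
have Um : U m by have [] := mU _ U1.
have [a ma aU] : exists2 a, lfset m a & theta a `<=` U.
  apply: contrapT => noa.
  have [q mq] : exists q, forall a, lfset m a -> (theta a `&` ~` U)%classic q.
    apply: (compact_directed latFilter_compact).
    - by exists \top; exact: filt1 (lf_filter m).
    - move=> a _; apply: closedI; first exact: (theta_clopen a).2.
      exact: open_closedC.
    - move=> a ma; apply/set0P/eqP => aU0; apply: noa; exists a => //.
      exact/subsets_disjoint.
    - move=> a b ma mb; exists (a `&` b).
        exact: filtI (lf_filter m) _ _ ma mb.
      move=> q [qab NUq]; split; split=> //; rewrite /theta /=;
        apply: filtS (lf_filter q) _ _ _ qab; [exact: leIl|exact: leIr].
  have [_ NUq] := mq _ (filt1 (lf_filter m)); apply: NUq.
  by apply: US Um; apply/asboolP => a /mq[].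
exists a; apply/seteqP; split=> // p Up.
exact: (mU _ Up).2.
Qed.

Lemma lf_lspace_clopenU (U V : clopenFilter (latFilter A)) :
  clopen (filter_join U V).
Proof.
have [a Ua] := theta_surj U; have [b Vb] := theta_surj V.
rewrite [filter_join _ _](_ : _ = theta (a `|` b)); first exact: theta_clopen.
rewrite Ua Vb; apply/seteqP; split=> [r [p [q [pa qb /asboolP pqr]]]|r rab].
  apply: pqr; split.
  - by apply: filtS (lf_filter p) _ _ _ pa; exact: leUl.
  - by apply: filtS (lf_filter q) _ _ _ qb; exact: leUr.
exists (lf_up a), (lf_up b); split; rewrite /theta /=; [exact: lexx..|].
apply/asboolP => c [/= ac bc]; apply: filtS (lf_filter r) _ _ _ rab.
by rewrite leUx ac.
Qed.

Lemma lf_lspace_clopen1 : clopen [set (\top : latFilter A)].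
Proof.
rewrite (_ : [set _] = theta \bot); first exact: theta_clopen.
apply/seteqP; split=> [p -> //|p p0]; apply: latFilter_eq.
by apply/seteqP; split=> // c _; apply: filtS (lf_filter p) _ _ (le0x c) p0.
Qed.

Lemma lf_lspace_sep p q : ~ p <= q ->
  exists U : clopenFilter (latFilter A), cfset U p /\ ~ cfset U q.
Proof.
move=> pq; apply: contrapT => noU; apply: pq; apply/asboolP => a pa.
by apply: contrapT => qa; apply: noU; exists (theta_cf a).
Qed.

HB.instance Definition _ :=
  isLSpace.Build set_display (latFilter A) latFilter_compact
    lf_lspace_clopen1 lf_lspace_clopenU lf_lspace_sep.

End ClopenFiltersOfFtop.

Section FtopSel.
Context {d : Order.disp_t} {A : condLatticeType d}.
Implicit Types (a b c : A) (p q r : latFilter A).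
Implicit Types U V : clopenFilter (latFilter A).

(* By [theta_surj] and [theta_inj], U is theta a for exactly one a. *)
Definition lf_sel p U : set (latFilter A) :=
  [set q | exists2 a, cfset U = theta a & [set b | lfset p (cimp a b)] `<=` lfset q].

Lemma lf_selE p U a : cfset U = theta a ->
  lf_sel p U = [set q : latFilter A | [set b | lfset p (cimp a b)] `<=` lfset q].
Proof.
move=> Ua; apply/seteqP; split=> [q [b Ub]|q pq]; last by exists a.
by rewrite -(theta_inj (etrans (esym Ua) Ub)).
Qed.

Lemma is_filter_cimp p a : is_filter [set b | lfset p (cimp a b)].
Proof.
split=> /=.
- by rewrite cimp1; exact: filt1 (lf_filter p).
- by move=> b c pb pc; rewrite -cimpI; exact: filtI (lf_filter p) _ _ pb pc.
- move=> b c bc; apply: filtS (lf_filter p) _ _ _.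
  by rewrite -(meet_l bc) -cimpI leIr.
Qed.

Definition lf_cimp p a : latFilter A := LatFilter (is_filter_cimp p a).

Lemma lf_sel_closed p U : closed (lf_sel p U).
Proof.
by have [a /(lf_selE p) ->] := theta_surj U; exact: closed_lf_up.
Qed.

Lemma lf_sel_filter p U : is_filter (lf_sel p U).
Proof.
have [a /(lf_selE p) ->] := theta_surj U; split=> //=.
- by move=> q r pq pr b pb; split; [exact: pq|exact: pr].
- by move=> q r /asboolP qr pq; exact: subset_trans qr.
Qed.

Lemma lf_sel_S1 U : lf_sel \top U = [set \top].
Proof.
have [a /(lf_selE \top) ->] := theta_surj U; apply/seteqP; split.
  by move=> q q1; apply: latFilter_eq; apply/seteqP; split=> // b _; exact: q1.
by move=> q ->.
Qed.

Lemma lf_sel_S2 p q U : p <= q -> lf_sel q U `<=` lf_sel p U.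
Proof.
move=> /asboolP pq; have [a Ua] := theta_surj U.
by rewrite !(lf_selE _ Ua) => r qr b /pq/qr.
Qed.

Lemma lf_sel_S3 p q r U : lf_sel (p `&` q) U r ->
  exists u v, [/\ lf_sel p U u, lf_sel q U v & u `&` v <= r].
Proof.
have [a Ua] := theta_surj U; rewrite !(lf_selE _ Ua) => /= pqr.
exists (lf_cimp p a), (lf_cimp q a); split=> //.
by apply/asboolP => b [pb qb]; exact: pqr.
Qed.

Lemma lf_sel_imp U V a b : cfset U = theta a -> cfset V = theta b ->
  [set p | lf_sel p U `<=` cfset V] = theta (cimp a b).
Proof.
move=> Ua ->; apply/seteqP; split=> [p /=|p pab].
  by rewrite (lf_selE _ Ua) => /(_ (lf_cimp p a)); apply.
by rewrite /= (lf_selE _ Ua) => q; apply.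
Qed.

Lemma lf_sel_St_clopen U V : clopen [set p | lf_sel p U `<=` cfset V].
Proof.
have [a Ua] := theta_surj U; have [b Vb] := theta_surj V.
by rewrite (lf_sel_imp Ua Vb); exact: theta_clopen.
Qed.

Lemma lf_sel_St_filter U V : is_filter [set p | lf_sel p U `<=` cfset V].
Proof.
have [a Ua] := theta_surj U; have [b Vb] := theta_surj V.
by rewrite (lf_sel_imp Ua Vb); exact: theta_filter.
Qed.

HB.instance Definition _ :=
  isSelection.Build set_display (latFilter A) lf_sel_closed lf_sel_filter
    lf_sel_S1 lf_sel_S2 lf_sel_S3 lf_sel_St_clopen lf_sel_St_filter.

End FtopSel.

Definition Ftop_obj (A : clat) : slspace :=
  @SLSpaceObj set_display (latFilter (cl_sort A)).

Lemma clmor_le d d' (A : condLatticeType d) (B : condLatticeType d')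
    (h : A -> B) : is_clmorphism h -> {homo h : a b / a <= b}.
Proof. by move=> hm a b ab; rewrite -(meet_l ab) (clmorI hm) leIr. Qed.

Lemma preimage_lf_filter (A B : clat) (h : clhom A B) (p : latFilter B) :
  is_filter (sval h @^-1` lfset p).
Proof.
case: h => h hm; case: p => p [p1 pI pS]; split=> /=.
- by rewrite (clmor1 hm).
- by move=> a b pa pb; rewrite (clmorI hm); exact: pI.
- by move=> a b ab; apply: pS; exact: clmor_le.
Qed.

Definition Ftop_fun (A B : clat) (h : clhom A B) :
    Ftop_obj B -> Ftop_obj A :=
  fun p => LatFilter (preimage_lf_filter h p).

Lemma is_filter_image_up (A B : clat) (h : clhom A B) (p : latFilter A) :
  is_filter [set b | exists2 a, lfset p a & sval h a <= b].
Proof.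
case: h => h hm; case: p => p [p1 pI pS]; split=> /=.
- by exists \top => //; exact: lex1.
- move=> b c [x px xb] [y py yc]; exists (x `&` y); first exact: pI.
  by rewrite (clmorI hm) leI2.
- by move=> b c bc [x px xb]; exists x => //; exact: le_trans bc.
Qed.

Lemma Ftop_is_lmorphism (A B : clat) (h : clhom A B) :
  is_lmorphism (Ftop_fun h).
Proof.
have hm := svalP h; split.
- by move=> p q; exact: latFilter_eq.
- move=> p; split=> [hp|->]; last exact: latFilter_eq.
  have p0 : lfset p \bot.
    have : lfset (Ftop_fun h p) \bot by rewrite hp.
    by rewrite /= (clmor0 hm).
  apply: latFilter_eq; apply/seteqP; split=> // b _.
  exact: filtS (lf_filter p) _ _ (le0x b) p0.
- move=> p q r /asboolP pqr.
  exists (LatFilter (is_filter_image_up h p)),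
    (LatFilter (is_filter_image_up h q)); split; apply/asboolP.
  + by move=> a pa; exists a.
  + by move=> a pa; exists a.
  + move=> b [[a pa ab] [c qc cb]].
    apply: filtS (lf_filter r) (sval h (a `|` c)) _ _ _.
      by rewrite (clmorU hm) leUx ab.
    apply: pqr; split.
      by apply: filtS (lf_filter p) _ _ _ pa; exact: leUl.
    by apply: filtS (lf_filter q) _ _ _ qc; exact: leUr.
Qed.

Lemma Ftop_continuous (A B : clat) (h : clhom A B) : continuous (Ftop_fun h).
Proof.
move=> p; have FF := fmap_filter (Ftop_fun h) (nbhs_filter p).
apply: latFilter_cvg => a pa.
- have [+ _] := theta_clopen (sval h a); rewrite openE => /(_ p); apply.
  exact: pa.
- have [_ /closed_openC] := theta_clopen (sval h a).
  by rewrite openE => /(_ p); apply; exact: pa.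
Qed.

Lemma Ftop_is_selmorphism (A B : clat) (h : clhom A B) :
  is_selmorphism (Ftop_fun h).
Proof.
have hm := svalP h.
apply: (@IsSelMorphism _ _ _ _ _ (Ftop_is_lmorphism h) (@Ftop_continuous _ _ h)).
all: move=> p U; have [a Ua] := theta_surj U.
all: have hUa : cfset (preimage_cf (Ftop_is_lmorphism h)
  (@Ftop_continuous _ _ h) U) = theta (sval h a) by rewrite /= Ua.
all: rewrite /sel /= => q; rewrite (lf_selE _ Ua) (lf_selE _ hUa) => pq.
- by move=> b /= pb; apply: pq; rewrite /= -(clmorC hm).
- exists (lf_cimp p (sval h a)); split=> //.
  by apply/asboolP => b pb; apply: pq; rewrite /= (clmorC hm).
Qed.

Definition Ftop_map (A B : clat) (h : clhom A B) :
    slhom (Ftop_obj B) (Ftop_obj A) :=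
  exist _ _ (Ftop_is_selmorphism h).

Program Definition Ftop : cofunctor CLat SLSpace :=
  @Cofunctor CLat SLSpace Ftop_obj Ftop_map _ _.
Next Obligation. by move=> A; apply: slhom_eq => p; exact: latFilter_eq. Qed.
Next Obligation.
by move=> A B C g f; apply: slhom_eq => p; exact: latFilter_eq.
Qed.

(* Main.v *)
(* The two units are x |-> {a : x in a} and a |-> theta a. The second is
   bijective because the clopen filters of the filter space are exactly the sets
   theta a. For the first, HMS separation makes principal down-sets closed, so by
   compactness every closed filter is principal. The intersection of a filter p of
   clopen filters is thus the up-set of a point x; by compactness again, a clopen
   filter containing that intersection contains a member of p, so p is the filter
   of x. Principality of s(x, a) gives (M2). *)
From mathcomp Require Import all_boot all_order.
From mathcomp Require Import boolp classical_sets functions filter.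
From mathcomp Require Import topology_structure compact.
Require Import Defs.

Set Implicit Arguments.
Unset Strict Implicit.
Unset Printing Implicit Defensive.

Import Order.TTheory.

Local Open Scope classical_set_scope.
Local Open Scope order_scope.

Section LSpaceTheory.
Context {d : Order.disp_t} {X : lSpaceType d}.
Implicit Types (x y : X) (F : set X) (a b : clopenFilter X).

Lemma clopenFilterS a x y : x <= y -> cfset a x -> cfset a y.
Proof. exact: filtS (cf_filter a) _ _. Qed.

Lemma lspace_leP x y : (forall a, cfset a x -> cfset a y) -> x <= y.
Proof.
move=> xy; apply: contrapT => /lspace_sep[a [ax nay]].
exact: nay (xy a ax).
Qed.

(** HMS separation, read contrapositively, makes the down-set the intersection of the complements of
    the clopen filters that miss [x]. *)
Lemma closed_down x : closed [set y | y <= x].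
Proof.
rewrite [X in closed X](_ : _ =
    (\bigcap_(a in [set a | ~ cfset a x]) ~` cfset a)%classic).
  by apply: closed_bigI => a _; exact/open_closedC/(cf_clopen a).1.
apply/seteqP; split=> [y yx a nax ay|y ny].
  exact: nax (clopenFilterS yx ay).
by apply: lspace_leP => a ay; apply: contrapT => nax; exact: ny nax ay.
Qed.

(** The parts of [F] below its various elements form a directed family of nonempty closed sets; a
    common point is the minimum. *)
Lemma closed_filter_min F : closed F -> is_filter F ->
  exists2 m, F m & forall x, F x -> m <= x.
Proof.
move=> Fcl Ff.
have [m mF] : exists m, forall x, F x -> (F `&` [set y | y <= x])%classic m.
  apply: (compact_directed lspace_compact).
  - by exists \top; exact: filt1 Ff.
  - by move=> x _; apply: closedI => //; exact: closed_down.
  - by move=> x Fx; exists x; split; [|exact: lexx].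
  - move=> x y Fx Fy; exists (x `&` y); first exact: filtI Ff _ _ Fx Fy.
    by move=> z [Fz] /=; rewrite lexI => /andP[zx zy].
exists m; first by have [] := mF _ (filt1 Ff).
by move=> x /mF[].
Qed.

(** If [b] is not in [p], no member of [p] lies inside [b], so the differences of the members of [p]
    with [b] are nonempty, closed and directed. By compactness they share a point, which lies in the
    intersection but not in [b]. *)
Lemma bigcap_clopen_sub (p : latFilter (clopenFilter X)) b :
  (\bigcap_(a in lfset p) cfset a)%classic `<=` cfset b -> lfset p b.
Proof.
move=> pb; apply: contrapT => npb.
have [x xp] : exists x, forall a, lfset p a ->
    (cfset a `&` ~` cfset b)%classic x.
  apply: (compact_directed lspace_compact).
  - by exists \top; exact: filt1 (lf_filter p).
  - move=> a _; apply: closedI; first exact: (cf_clopen a).2.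
    exact/open_closedC/(cf_clopen b).1.
  - move=> a pa; apply/set0P/eqP => ab0; apply: npb.
    apply: (filtS (lf_filter p) _ pa).
    by apply/asboolP; exact/subsets_disjoint.
  - move=> a a' pa pa'; exists (a `&` a').
      exact: filtI (lf_filter p) _ _ pa pa'.
    by move=> x [[ax a'x] nbx].
have [_ nbx] := xp _ (filt1 (lf_filter p)).
by apply/nbx/pb => a /xp[].
Qed.

Lemma is_filter_point x : is_filter [set a : clopenFilter X | cfset a x].
Proof.
by split=> [//|a b ax bx|a b /asboolP ab ax]; [split|exact: ab].
Qed.

Definition point_filter x : latFilter (clopenFilter X) :=
  LatFilter (is_filter_point x).

Lemma point_filter_le x y : (point_filter x <= point_filter y) = (x <= y).
Proof.
apply/asboolP/idP => [xy|xy a]; last exact: clopenFilterS.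
by apply: lspace_leP => a; exact: xy.
Qed.

Lemma point_filter_surj p : exists x, point_filter x = p.
Proof.
have [||x xp xmin] := @closed_filter_min
    (\bigcap_(a in lfset p) cfset a)%classic.
- by apply: closed_bigI => a _; exact: (cf_clopen a).2.
- split=> [a _|x y xp yp a pa|x y xy xp a pa].
  + exact: filt1 (cf_filter a).
  + exact: filtI (cf_filter a) _ _ (xp a pa) (yp a pa).
  + exact: clopenFilterS xy (xp a pa).
exists x; apply: latFilter_eq; apply/seteqP; split=> [b bx|a /xp//].
apply: bigcap_clopen_sub => y /xmin xy; exact: clopenFilterS xy bx.
Qed.

Lemma point_filterI : {morph point_filter : x y / x `&` y}.
Proof.
move=> x y; apply: latFilter_eq; apply/seteqP; split=> [a axy|a [ax ay]].
  by split; [exact: clopenFilterS (leIl x y) axy|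
             exact: clopenFilterS (leIr y x) axy].
exact: filtI (cf_filter a) _ _ ax ay.
Qed.

Definition filter_point p : X := projT1 (cid (point_filter_surj p)).

Lemma filter_pointK : cancel filter_point point_filter.
Proof. by move=> p; rewrite /filter_point; case: cid. Qed.

Lemma point_filterK : cancel point_filter filter_point.
Proof.
by move=> x; apply/le_anti; rewrite -!point_filter_le filter_pointK lexx.
Qed.

Lemma point_filter_continuous : continuous point_filter.
Proof.
move=> x; have FF := fmap_filter point_filter (nbhs_filter x).
apply: latFilter_cvg => a xa; apply: open_nbhs_nbhs; split=> //.
  exact: (cf_clopen a).1.
exact/closed_openC/(cf_clopen a).2.
Qed.

Lemma filter_point_continuous : continuous filter_point.
Proof.
(* A cluster point outside O of the images of the neighbourhoods of p would
   have point filter p, hence would be filter_point p, which lies in O. *)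
move=> p W; rewrite nbhsE => -[O [oO Op] OW].
have pF := fmap_filter filter_point (nbhs_filter p).
apply: (@filterS _ _ _ O) => //; apply: contrapT => nO.
set F := within (~` O)%classic (filter_point @ p).
have FF : ProperFilter F.
  have FF : Filter F by exact: within_filter.
  split=> // F0; apply: nO.
  apply: (@filterS _ (nbhs (filter_point @ p)) pF _ _ _ F0) => q nq.
  by apply: contrapT => nOq; exact: nq.
have [y [_ yF]] := lspace_compact F FF filterT.
have Oy : O y.
  suff -> : y = filter_point p by [].
  apply: (can_inj point_filterK); rewrite filter_pointK; apply: latFilter_eq.
  have Fpreim (U : set (latFilter (clopenFilter X))) :
      open U -> U p -> F (point_filter @^-1` U).
    move=> oU Up; apply: (@filterS _ (nbhs p) (nbhs_filter p) U).
      by move=> q Uq _; rewrite /= filter_pointK.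
    exact: open_nbhs_nbhs.
  (* If [a] told [p] and [point_filter y] apart, a set in [F] and a neighbourhood of [y] would lie
     on opposite sides of [a], though [y] is a cluster point of [F]. *)
  apply/seteqP; split=> a; apply: contraPP.
  - move=> npa ya; have Na : nbhs y (cfset a).
      by apply: open_nbhs_nbhs; split=> //; exact: (cf_clopen a).1.
    have oNa : open (~` theta a)%classic.
      exact/closed_openC/(theta_clopen a).2.
    by have [z []] := yF _ _ (Fpreim _ oNa npa) Na.
  - move=> nya pa; have NNa : nbhs y (~` cfset a)%classic.
      by apply: open_nbhs_nbhs; split=> //; exact/closed_openC/(cf_clopen a).2.
    by have [z []] := yF _ _ (Fpreim _ (theta_clopen a).1 pa) NNa.
have NO : nbhs y O by exact: open_nbhs_nbhs.
by have [z []] := yF _ _ (withinT _ pF) NO.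
Qed.

Lemma point_filter_is_lmorphism : is_lmorphism point_filter.
Proof.
split.
- exact: point_filterI.
- move=> x; split=> [x1|->].
    by apply/le_anti; rewrite lex1 -point_filter_le x1 lex1.
  apply: latFilter_eq; apply/seteqP; split=> // a _.
  exact: filt1 (cf_filter a).
(* As [point_filter] is an order isomorphism, the exact preimages of [p] and [q] are witnesses. *)
- move=> p q x; exists (filter_point p), (filter_point q).
  by rewrite !filter_pointK -point_filter_le point_filterI !filter_pointK.
Qed.

End LSpaceTheory.

Lemma point_filter_is_selmorphism d (X : selLSpaceType d) :
  is_selmorphism (@point_filter d X).
Proof.
have L := @point_filter_is_lmorphism d X.
have C := @point_filter_continuous d X.
apply: (@IsSelMorphism _ _ _ _ _ L C) => x U; have [a Ua] := theta_surj U.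
all: have -> : preimage_cf L C U = a by apply: clopenFilter_eq; rewrite /= Ua.
all: rewrite [sel (point_filter x) U](lf_selE _ Ua).
  by move=> y xy b xb; exact: xb.
move=> q xq; exists (filter_point q); split; last by rewrite filter_pointK.
(* For (M2), let [m] be the least element of [sel x a]. A clopen filter [b] containing [m] contains
   all of [sel x a], so [x] lies in [sel_imp a b] and [b] is in [q]. Hence [m] is below the point of
   [q]. *)
have [m sm mmin] := closed_filter_min (sel_closed x a) (sel_filter x a).
apply: (filtS (sel_filter x a)) sm; rewrite -point_filter_le filter_pointK.
apply/asboolP => b mb; apply: xq => y /mmin my; exact: clopenFilterS my mb.
Qed.

Lemma selmorphism_inv d d' (X : selLSpaceType d) (Y : selLSpaceType d')
    (f : X -> Y) (g : Y -> X) :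
  cancel f g -> cancel g f -> continuous g -> is_selmorphism f ->
  is_selmorphism g.
Proof.
move=> fK gK gc [fL fc fM1 fM2].
have gI : {morph g : x y / x `&` y}.
  by move=> x y; rewrite -{1}(gK x) -{1}(gK y) -(lmorI fL) fK.
have gL : is_lmorphism g.
  split=> [//|x|y z x yzx].
    by rewrite -(lmor1 fL) gK.
  exists (f y), (f z); rewrite !fK; split=> //.
  by rewrite -(lmorI fL) -(gK x); exact: lmor_le.
have gfK a : preimage_cf fL fc (preimage_cf gL gc a) = a.
  by apply: clopenFilter_eq; apply/seteqP; split=> x; rewrite /= fK.
apply: (@IsSelMorphism _ _ _ _ _ gL gc) => x a y.
  rewrite -{1}(gK x) => /fM2[z []]; rewrite gfK => xz zy.
  by apply: (filtS (sel_filter _ _)) xz; rewrite -(fK z); exact: lmor_le zy.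
move=> xy; exists (f y); rewrite fK; split=> //.
by rewrite -(gK x); apply: fM1; rewrite gfK.
Qed.

Lemma clmorphism_inv d d' (A : condLatticeType d) (B : condLatticeType d')
    (h : A -> B) (g : B -> A) :
  cancel h g -> cancel g h -> is_clmorphism h -> is_clmorphism g.
Proof.
move=> hK gK [h1 h0 hI hU hC]; split; rewrite -?h1 -?h0 ?hK// => a b.
- by rewrite -{1}(gK a) -{1}(gK b) -hI hK.
- by rewrite -{1}(gK a) -{1}(gK b) -hU hK.
- by rewrite -{1}(gK a) -{1}(gK b) -hC hK.
Qed.

Lemma theta_cf_is_clmorphism d (A : condLatticeType d) :
  is_clmorphism (@theta_cf d A).
Proof.
split=> [||a b|a b|a b]; apply: clopenFilter_eq.
- by apply/seteqP; split=> // p _; exact: filt1 (lf_filter p).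
- apply/seteqP; split=> [p p0|p -> //]; apply: latFilter_eq.
  by apply/seteqP; split=> // b _; exact: filtS (lf_filter p) _ _ (le0x b) p0.
- apply/seteqP; split=> [p pab|p [pa pb]].
    by split; apply: filtS (lf_filter p) _ _ _ pab; [exact: leIl|exact: leIr].
  exact: filtI (lf_filter p) _ _ pa pb.
- apply/seteqP; split=> [p pab|p [q [r [qa rb /asboolP qrp]]]].
    (* The principal filters of [a] and [b] meet in that of the join of [a] and [b], which is below
       [p]. *)
    exists (lf_up a), (lf_up b); split; [exact: lexx|exact: lexx|].
    apply/asboolP => c [/= ac bc]; apply: filtS (lf_filter p) _ _ _ pab.
    by rewrite leUx ac.
  by apply: qrp; split; [apply: filtS (lf_filter q) _ _ _ qa; exact: leUl|
                         apply: filtS (lf_filter r) _ _ _ rb; exact: leUr].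
- exact/esym/lf_sel_imp.
Qed.

Lemma theta_cf_inv d (A : tbLatticeType d) :
  exists2 g, cancel (@theta_cf d A) g & cancel g (@theta_cf d A).
Proof.
have /choice[g gE] := @theta_surj d A; exists g => [a|U].
  by apply: theta_inj; rewrite -gE.
by apply: clopenFilter_eq; exact/esym/gE.
Qed.

Theorem theorem4p8 : dual_equivalence Fclp Ftop.
Proof.
split.
- exists (fun X : slspace => exist _ _ (@point_filter_is_selmorphism _ X) :
    slhom X (Ftop_obj (Fclp_obj X))).
  split=> [X Y f|X].
    (* Naturality is definitional: [a] contains [f x] exactly when the preimage of [a] contains
       [x]. *)
    by apply: slhom_eq => x; exact: latFilter_eq.
  have gm := selmorphism_inv point_filterK filter_pointK
    (@filter_point_continuous _ X) (@point_filter_is_selmorphism _ X).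
  exists (exist _ _ gm); split; apply: slhom_eq => x; first exact: point_filterK.
  exact: filter_pointK.
- exists (fun A : clat => exist _ _ (@theta_cf_is_clmorphism _ A) :
    clhom A (Fclp_obj (Ftop_obj A))).
  split=> [A B h|A].
    (* Likewise, [h a] is in [p] exactly when [a] is in the preimage of [p] under [h]. *)
    by apply: clhom_eq => a; exact: clopenFilter_eq.
  have [g hK gK] := @theta_cf_inv _ A.
  have gm := clmorphism_inv hK gK (@theta_cf_is_clmorphism _ A).
  by exists (exist _ _ gm); split; apply: clhom_eq => a; [exact: hK|exact: gK].
Qed.
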